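(* Let $G$ be a graph on an oriented surface $\Sigma$ and let $G^*$ be its dual graph. The map $AO(G)\to TBO(G^* )$ sending $\mathfrak{o}$ to its dual orientation $\mathfrak{o}^*$ is bijective.
   Context: Graphs may have loops and multiple edges. A graph on a surface $G=(V,E,F)$ is a graph $(V,E)$ cellularly embedded in a closed oriented (not necessarily connected) surface $\Sigma$, i.e. the complement $\Sigma\setminus G$ is a disjoint union of discs; these discs are the faces, and $F$ is the set of faces. Dual graph: $G^*$ is the graph on the same surface $\Sigma$ having one vertex for each face of $G$, one face for each vertex of $G$, and for each edge $e$ of $G$ one dual edge $e^*$ crossing $e$ and joining the (possibly equal) faces on the two sides of $e$. An orientation of $G$ assigns a direction to each edge. The dual orientation $\mathfrak{o}^*$ of an orientation $\mathfrak{o}$ of $G$ is the orientation of $G^*$ such that for each edge $e$ the pair of directed edges $(\overrightarrow{e},\overrightarrow{e}^{*})$ is a positively oriented ordered pair with respect to the orientation of $\Sigma$. Acyclic orientation: an orientation with no directed cycle (a directed loop counts as a directed cycle). $AO(G)$ is the set of acyclic orientations of $G$. Cocycle: a cocycle of a graph $H$ on a surface is a sequence $(f_0,e_1,f_1,\dots,e_k,f_k=f_0)$ of non-repeating edges and faces of $H$ such that consecutive faces and edges are adjacent; equivalently, its edges are dual to the edges of a cycle of $H^*$. A cocycle is identified with its edge set. Topologically a cocycle forms an annulus whose core is its dual cycle, bounded by two circles, and each edge of the cocycle crosses this annulus from one boundary circle to the other. For an orientation of $H$, a pair $(e_1,e_2)$ of edges of a cocycle $C$ is coherently oriented with respect to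 $C$ if both edges are directed from the same boundary circle of this annulus to the other. Walks: a walk is a sequence $(v_0,e_1,v_1,\dots,e_k,v_k)$ of vertices and edges (repetitions allowed) with consecutive ones incident; it is closed if $v_k=v_0$; it is directed (with respect to an orientation $\mathfrak{o}$) if each edge is traversed according to its direction in $\mathfrak{o}$. For a directed walk $W$ and cocycle $C$, $C\cap W$ denotes the intersection of the edge set of $C$ with the (undirected) edge set of $W$. A directed closed walk $W$ is bidirectional if for every cocycle $C$ with $C\cap W\neq\emptyset$ there is a pair $(e_1,e_2)$ of edges in $C\cap W$ that is not coherently oriented with respect to $C$. An orientation is totally bi-walkable if for every edge $e$ there is a bidirectional closed walk $W_e$ containing $e$. $TBO(H)$ is the set of totally bi-walkable orientations of $H$. *)

(* Defs.v *)
From mathcomp Require Import all_boot all_fingroup.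
From mathcomp Require classical_sets functions.

Set Implicit Arguments.
Unset Strict Implicit.
Unset Printing Implicit Defensive.

Local Open Scope group_scope.

(* A graph cellularly embedded in a closed oriented, possibly disconnected,
   surface, presented as a combinatorial map.  A dart is an edge with a
   direction; [opp] reverses it, and [rotation] sends a dart to the next dart,
   counterclockwise, with the same initial vertex.  An edgeless component is a
   single vertex on a sphere; it has no dart and is counted by [isolated]. *)
Record surface_graph := SurfaceGraph {
  dart : finType;
  rotation : {perm dart};
  opp : {perm dart};
  isolated : finType;
  oppK : involutive opp;
  opp_neq : forall d, opp d != d
}.

Arguments rotation {s}.
Arguments opp {s}.
Arguments oppK {s}.
Arguments opp_neq {s}.

Section SurfaceGraph.
Variable G : surface_graph.
Implicit Types (d : dart G) (c w : seq (dart G)).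

(* Follows the boundary of the face on the left of a dart: at the end of [d],
   leave along the dart that comes just before [opp d] in counterclockwise
   order.  This runs counterclockwise around that face. *)
Definition face_perm : {perm dart G} := opp * rotation^-1.

(* Vertices and faces are orbits of darts, plus one vertex and one face for
   each edgeless component. *)
Definition cell : Type := ({set dart G} + isolated G)%type.
Definition orbit_cells (s : {perm dart G}) : {set cell} :=
  [set inl A | A in porbits s] :|: [set inr i | i in [set: isolated G]].
Definition vertices : {set cell} := orbit_cells rotation.
Definition faces : {set cell} := orbit_cells face_perm.

Definition tail d : cell := inl (porbit rotation d).
Definition head d : cell := tail (opp d).
Definition left_face d : cell := inl (porbit face_perm d).
Definition right_face d : cell := left_face (opp d).

Definition edge d : {set dart G} := [set d; opp d].
Definition edges : {set {set dart G}} := [set edge d | d in [set: dart G]].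
Definition edge_set c : {set {set dart G}} := [set edge d | d in c].

(* An orientation is the set of the darts it selects, one for each edge. *)
Definition orientation : Type :=
  {o : {set dart G} | [forall d, (opp d \in o) == (d \notin o)]}.
Implicit Type o : orientation.

Definition directed o w : Prop := {subset w <= val o}.

(* The walk [v_0, e_1, v_1, ..., e_k, v_k = v_0] is given by its sequence of
   traversed darts, the i-th dart going from [v_(i-1)] to [v_i] along [e_i]. *)
Definition closed_walk w : bool := path.cycle (fun x y => head x == tail y) w.

Definition graph_cycle c : bool :=
  [&& c != [::], closed_walk c, uniq (map edge c) & uniq (map tail c)].

Definition acyclic o : Prop := ~ exists c, graph_cycle c /\ directed o c.

Definition AO : classical_sets.set orientation := acyclic.

(* The cocycle [f_0, e_1, f_1, ..., e_k, f_k = f_0] is given by the darts of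
   the [e_i] having [f_(i-1)] on the right and [f_i] on the left.  As the core
   of the annulus crosses such a dart from its right to its left, the dart
   crosses the core from left to right. *)
Definition cocycle c : bool :=
  [&& c != [::], path.cycle (fun x y => left_face x == right_face y) c,
      uniq (map edge c) & uniq (map right_face c)].

(* The edge [e] is directed by [o] from the left boundary circle of the annulus
   of the cocycle [c] to the right one, respectively from right to left. *)
Definition left_to_right o c (e : {set dart G}) : bool :=
  [exists d in e, (d \in val o) && (d \in c)].
Definition right_to_left o c (e : {set dart G}) : bool :=
  [exists d in e, (d \in val o) && (opp d \in c)].

Definition coherently_oriented o c (e1 e2 : {set dart G}) : bool :=
  left_to_right o c e1 && left_to_right o c e2 ||
  right_to_left o c e1 && right_to_left o c e2.

Definition bidirectional o w : Prop :=
  [/\ closed_walk w, directed o w &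
      forall c, cocycle c -> edge_set c :&: edge_set w != set0 ->
        exists e1 e2, [/\ e1 \in edge_set c :&: edge_set w,
                          e2 \in edge_set c :&: edge_set w &
                          ~~ coherently_oriented o c e1 e2]].

Definition totally_biwalkable o : Prop :=
  forall e, e \in edges -> exists w, bidirectional o w /\ e \in edge_set w.

Definition TBO : classical_sets.set orientation := totally_biwalkable.

End SurfaceGraph.

Arguments AO : clear implicits.
Arguments TBO : clear implicits.

(* In the dual, the dart [d] stands for the dual edge which leaves the face on
   the left of [d], crossing [d] from left to right. *)
Definition dual (G : surface_graph) : surface_graph :=
  @SurfaceGraph (dart G) (face_perm G) opp (isolated G) oppK opp_neq.

(* The dual dart which makes a positively oriented pair with [d]: it crosses
   [d] from right to left. *)
Definition dual_dart (G : surface_graph) (d : dart G) : dart (dual G) := opp d.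

Section Dual.
Variable G : surface_graph.
Implicit Types (d x y : dart G) (o : orientation G).

Lemma tail_dual_dart d : tail (dual_dart d) = right_face d.
Proof. by []. Qed.

Lemma head_dual_dart d : head (dual_dart d) = left_face d.
Proof. by rewrite /head /dual_dart /= oppK. Qed.

Lemma vertices_dual : vertices (dual G) = faces G.
Proof. by []. Qed.

Lemma face_perm_dual d :
  face_perm (dual G) (dual_dart d) = dual_dart (rotation d).
Proof.
have oppV y : (opp^-1 : {perm dart G}) y = opp y.
  by apply: (@perm_inj _ opp); rewrite permKV oppK.
by rewrite /dual_dart {1}/face_perm permM /= oppK /face_perm invMg invgK permM oppV.
Qed.

Lemma left_face_dual_dart x y :
  left_face (dual_dart x) = left_face (dual_dart y) <-> tail x = tail y.
Proof.
have iterE n d : (face_perm (dual G) ^+ n) (dual_dart d)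
                 = dual_dart ((rotation ^+ n) d).
  elim: n => [|n IHn]; first by rewrite !expg0 !perm1.
  by rewrite !expgSr permM [in RHS]permM IHn; apply: face_perm_dual.
split=> -[] /eqP; rewrite eq_porbit_mem => /porbitP[n E]; congr inl; apply/eqP;
  rewrite eq_porbit_mem; apply/porbitP; exists n.
  by apply: (@perm_inj _ opp); rewrite -[opp x]/(dual_dart x) E iterE.
by rewrite iterE E.
Qed.

Lemma dual_orientation_subproof o :
  [forall d : dart (dual G),
     (opp d \in [set dual_dart x | x in val o])
       == (d \notin [set dual_dart x | x in val o])].
Proof.
have memE d : (d \in [set dual_dart x | x in val o]) = (opp d \in val o).
  by rewrite -{1}[d]oppK (mem_imset _ _ (@perm_inj _ opp)).
apply/forallP => d; rewrite !memE; exact: (forallP (valP o)).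
Qed.

Definition dual_orientation o : orientation (dual G) :=
  exist _ [set dual_dart x | x in val o] (dual_orientation_subproof o).

End Dual.

(* Main.v *)
From mathcomp Require Import all_boot all_fingroup.
From mathcomp Require classical_sets functions.
Require Import Defs.

(** A cocycle of [G^*] is a cycle of [G], and it is coherently oriented exactly
    when one of its two directions is directed; so a directed cycle of [G] is
    met by no bidirectional walk of [G^*].  Conversely, let [o] be acyclic.  If
    a set of faces of [G] can be entered but not left along [o^*], its boundary
    is a nonempty set of darts of [o] in which every dart has a successor,
    hence it contains a directed cycle.  So every component of [G^*] is
    strongly connected under [o^*], and one closed walk covers it.  A cocycle
    that meets this walk has all its edges on it, and they are not pairwise
    coherent. *)

Set Implicit Arguments.
Unset Strict Implicit.
Unset Printing Implicit Defensive.

Local Open Scope group_scope.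

(** * Periodicity and orbits on finite sets *)

Lemma exists_periodic (T : finType) (f : T -> T) (P : pred T) x :
  P x -> (forall y, P y -> P (f y)) -> exists2 y, P y & fcycle f (fingraph.orbit f y).
Proof.
move=> Px fP.
have Piter n : P (iter n f x) by elim: n => //= n; apply: fP.
have /trajectP[i lt_i E] := looping_order f x.
exists (iter i f x) => //.
apply/(orbitPcycle 3 0); exists (fingraph.order f x - i).-1.
by rewrite prednK ?subn_gt0 // -iterD subnK // ltnW.
Qed.

(** Iterating [s] from [s x] comes back to [x], so [P] must turn from false to true on the way. *)
Lemma perm_step_orbit (T : finType) (s : {perm T}) (P : pred T) x :
  P x -> ~~ P (s x) -> exists2 y, y \in porbit s (s x) & ~~ P y && P (s y).
Proof.
move=> Px nPsx; apply/exists_inP; apply: contraLR Px => /exists_inPn noP.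
have nP n : ~~ P ((s ^+ n) (s x)).
  elim: n => [|n IHn]; first by rewrite perm1.
  rewrite expgSr permM; have := noP _ (mem_porbit s n (s x)).
  by rewrite IHn.
have := nP #[s].-1.
by rewrite -permM -expgS prednK ?order_gt0 // expg_order perm1.
Qed.

(** * Darts, faces and directed cycles *)

Section SurfaceGraph.
Variable G : surface_graph.
Implicit Types (d x y : dart G) (o : orientation G) (c : seq (dart G)).

Lemma orientation_opp o d : (opp d \in val o) = (d \notin val o).
Proof. exact/eqP/(forallP (valP o)). Qed.

Lemma edge_opp d : edge (opp d) = edge d.
Proof. by rewrite /edge oppK setUC. Qed.

Lemma edge_eq x y : edge x = edge y -> x = y \/ x = opp y.
Proof.
move=> E; have: x \in edge y by rewrite -E set21.
by case/set2P; [left | right].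
Qed.

Lemma edge_inj_directed o : {in val o &, injective (@edge G)}.
Proof.
by move=> x y xo yo /edge_eq[] // E; move: xo; rewrite E orientation_opp yo.
Qed.

Lemma edge_inj_uniq c : uniq (map (@edge G) c) -> {in c &, injective (@edge G)}.
Proof.
move=> + x y xc yc E => /uniqP U.
have := U set0 (index x c) (index y c).
rewrite !inE !size_map !index_mem !(nth_map x) ?index_mem // !nth_index //.
by move=> /(_ xc yc E) /(congr1 (nth x c)); rewrite !nth_index.
Qed.

Lemma edge_setP c e :
  reflect (exists2 d, d \in c & e = edge d) (e \in edge_set c).
Proof. exact: imsetP. Qed.

(** The corner between two consecutive darts at a vertex lies in a single face. *)
Lemma right_face_rotation d : right_face (rotation d) = left_face d.
Proof.
congr inl; have {2}-> : d = face_perm G (opp (rotation d)).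
  by rewrite permM oppK permK.
exact/esym/(porbit_perm _ 1).
Qed.

Lemma tail_eq x y : (tail x == tail y) = (x \in porbit rotation y).
Proof. by rewrite -eq_porbit_mem; apply/eqP/eqP => [[]|E] //; congr inl. Qed.

Lemma tail_rotation d : tail (rotation d) = tail d.
Proof. by congr inl; apply: (porbit_perm _ 1). Qed.

(** Distinctness of the edges keeps [opp d] out of [c], so [d] alone decides the direction. *)
Lemma left_to_right_edge o c d :
  uniq (map (@edge G) c) -> d \in c ->
  left_to_right o c (edge d) = (d \in val o).
Proof.
move=> Uc dc; apply/existsP/idP => [[y /and3P[/set2P[]-> // _ oc]]|]; last first.
  by exists d; rewrite set21 dc andbT.
have := edge_inj_uniq Uc oc dc (edge_opp d) => E.
by have := opp_neq d; rewrite E eqxx.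
Qed.

Lemma right_to_left_edge o c d :
  uniq (map (@edge G) c) -> d \in c ->
  right_to_left o c (edge d) = (d \notin val o).
Proof.
move=> Uc dc; apply/existsP/idP => [[y /and3P[/set2P[]-> // + oc]]|]; last first.
- by rewrite -orientation_opp; exists (opp d); rewrite set22 oppK dc andbT.
- by rewrite orientation_opp.
have := edge_inj_uniq Uc oc dc (edge_opp d) => E.
by have := opp_neq d; rewrite E eqxx.
Qed.

(** Following successors inside [B] ends in a periodic orbit; its edges are distinct because [o]
    holds only one dart of each edge. *)
Lemma graph_cycle_exists o (B : pred (dart G)) x :
  B x -> {subset B <= val o} ->
  (forall y, B y -> exists2 z, B z & tail z = head y) ->
  exists c, graph_cycle c /\ directed o c.
Proof.
move=> Bx Bo Bsucc.
(* The successor depends on [y] only through [head y], so a cycle of [f]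
   repeats no vertex. *)
pose f y := odflt y [pick z | B z && (tail z == head y)].
have fP y : B y -> B (f y) /\ tail (f y) = head y.
  rewrite /f => /Bsucc[z Bz /eqP tz]; case: pickP => [u /andP[Bu /eqP]//|].
  by move/(_ z); rewrite Bz tz.
have f_head y z : B y -> head y = head z -> f y = f z.
  move=> /Bsucc[u Bu /eqP tu] E; rewrite /f E; case: pickP => // /(_ u).
  by rewrite Bu -E tu.
have [y By cyc] := exists_periodic Bx (fun z Bz => (fP z Bz).1).
have allB : {subset fingraph.orbit f y <= B}.
  move=> z; rewrite -fconnect_orbit => /iter_findex <-.
  by elim: (findex _ _ _) => //= n /fP[].
have inj_o : {in fingraph.orbit f y &, injective (@edge G)}.
  by move=> u v /allB/Bo uo /allB/Bo; apply: edge_inj_directed.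
exists (fingraph.orbit f y); split; last by move=> z /allB/Bo.
apply/and4P; split; last 2 first.
- by rewrite (map_inj_in_uniq inj_o) orbit_uniq.
- rewrite map_inj_in_uniq ?orbit_uniq // => u v uc vc.
  (* Two darts of the orbit with the same tail are images of darts of [B] with the same head, so
     [f_head] identifies them. *)
  have onto t : t \in fingraph.orbit f y -> exists2 t', B t' & f t' = t.
    move=> tc; exists (prev (fingraph.orbit f y) t); last exact/eqP/(prev_cycle cyc).
    by apply: allB; rewrite mem_prev.
  have [[u' Bu' <-] [v' Bv' <-]] := (onto u uc, onto v vc).
  by rewrite (fP _ Bu').2 (fP _ Bv').2; apply: f_head.
- by rewrite -size_eq0 size_orbit -lt0n fingraph.order_gt0.
apply: (sub_in_cycle (P := mem (fingraph.orbit f y))) cyc; last exact/allP.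
by move=> u v /allB Bu _ /= /eqP<-; rewrite (fP _ Bu).2.
Qed.

(* When [d \notin val o], the dual orientation crosses [d] from left to right. *)
Lemma acyclic_face_closed o (R : {set cell G}) :
  acyclic o ->
  (forall d, d \notin val o -> left_face d \in R -> right_face d \in R) ->
  forall d, (left_face d \in R) = (right_face d \in R).
Proof.
move=> aco clR.
have enter d : d \notin val o -> right_face d \in R -> left_face d \in R.
  move=> ndo dR; apply/negP => /negP dnR; apply: aco.
  (* The boundary of [R], made of darts of [o] with [R] on their left. *)
  pose B := [pred x | [&& x \in val o, right_face x \notin R & left_face x \in R]].
  have Bd : B (opp d) by rewrite /= orientation_opp ndo /right_face oppK dnR.
  apply: (graph_cycle_exists Bd) => [x /and3P[]//|x /and3P[xo rx lx]].
  (* Turning counterclockwise around the head of [x], [opp x] is crossed out of [R], so some later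
     dart is crossed back into [R]. By [clR] that dart lies in [o]; it is the successor of [x]. *)
  have := @perm_step_orbit _ rotation [pred z | left_face z \in R]
                           (rotation^-1 (opp x)).
  rewrite permKV /= -right_face_rotation permKV /right_face oppK => /(_ lx rx).
  case=> z0 z0x /andP[nz0 z1].
  exists (rotation z0); last by rewrite tail_rotation; apply/eqP; rewrite tail_eq.
  rewrite /= -/(right_face _) z1 right_face_rotation nz0 !andbT.
  by apply: contraR nz0 => /clR/(_ z1); rewrite right_face_rotation.
move=> d; case: (boolP (d \in val o)) => ndo; last first.
  by apply/idP/idP; [apply: clR | apply: enter].
have od : opp d \notin val o by rewrite orientation_opp ndo.
have rod : right_face (opp d) = left_face d by rewrite /right_face oppK.
apply/idP/idP => [|/(clR _ od)]; last by rewrite rod.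
by rewrite -{1}rod; apply: enter.
Qed.

(** * Strong connectedness of the dual and covering walks *)

Section Acyclic.
Variable o : orientation G.
Hypothesis aco : acyclic o.

(** Darts outside [o] are the directed dual edges, crossed from left to right: [y] leaves the face
    that [x] enters. *)
Let step : rel (dart G) :=
  fun x y => (y \notin val o) && (right_face x == left_face y).

Let reach x : {set cell G} := [set right_face y | y in connect step x].

(** A reachable face can be left along any dart outside [o], so acyclicity lets [reach x] be crossed
    both ways at every dart. *)
Lemma reach_closed x d : (left_face d \in reach x) = (right_face d \in reach x).
Proof.
apply: (acyclic_face_closed aco) => {}d ndo /imsetP[z xz E].
by apply/imset_f/(connect_trans xz)/connect1; rewrite /step ndo E /=.
Qed.

Lemma reach_last x d :
  left_face d \in reach x -> exists2 z, connect step x z & right_face z = left_face d.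
Proof. by case/imsetP=> z xz E; exists z. Qed.

Lemma connect_reach x d :
  d \notin val o -> left_face d \in reach x -> connect step x d.
Proof.
move=> ndo /reach_last[z xz E]; apply: connect_trans xz (connect1 _).
by rewrite /step ndo E /=.
Qed.

Lemma reach_right_face x : right_face x \in reach x.
Proof. exact/imset_f/connect0. Qed.

(** Each single step from [x] to [z] can be undone: [reach z] contains the right face of [x], hence
    also its left face, from which [x] can be taken. *)
Lemma connect_step_sym x y :
  x \notin val o -> connect step x y -> connect step y x.
Proof.
move=> + /connectP[p + ->]; elim: p x => [|z p IHp] x xo /=.
  by rewrite connect0.
case/andP=> /andP[zo /eqP xz] /(IHp _ zo) zx; apply: connect_trans zx _.
apply: connect_reach => //; rewrite reach_closed xz reach_closed.
exact: reach_right_face.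
Qed.

Lemma covering_path x (s : seq (dart G)) :
  x \notin val o -> (forall y, y \in s -> connect step x y) ->
  exists p, [/\ path step x p, step (last x p) x & {subset s <= x :: p}].
Proof.
move=> xo; elim: s => [|y s IHs] xs.
  (* Even with nothing to cover, the walk must return to the left face of [x] to close up. *)
  have /reach_last[z /connectP[p xp ->] E] : left_face x \in reach x.
    by rewrite reach_closed reach_right_face.
  by exists p; split=> //; rewrite /step xo E /=.
have [|p [xp px sp]] := IHs; first by move=> z zs; apply: xs; rewrite inE zs orbT.
have /connectP[q xq Eq] := xs _ (mem_head y s).
have /connectP[r yr Er] : connect step y x.
  by apply: connect_step_sym => //; apply: xs; rewrite mem_head.
(* A detour to [y] along [q] and back to [x] along [r], before the walk [p] covering the rest. *)
exists (q ++ r ++ p); rewrite !cat_path !last_cat -Eq -Er; split=> //.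
  by rewrite xq yr.
move=> z; rewrite inE => /predU1P[->|/sp].
  by rewrite -cat_cons mem_cat Eq mem_last.
by rewrite !inE !mem_cat => /predU1P[->|->]; rewrite ?eqxx ?orbT.
Qed.

Lemma path_step_notin x p : path step x p -> {subset p <= [predC val o]}.
Proof.
elim: p x => //= y p IHp x /andP[/andP[yo _] /IHp po] z.
by rewrite inE => /predU1P[->|/po].
Qed.

Lemma left_face_porbit x y z :
  tail y = tail z -> left_face y \in reach x -> left_face z \in reach x.
Proof.
move=> /esym/eqP; rewrite tail_eq => /porbitP[n ->].
elim: n => [|n IHn] yx; first by rewrite perm1.
by rewrite expgSr permM reach_closed right_face_rotation; apply: IHn.
Qed.

(** Consecutive darts of [c] share a vertex, and turning around it crosses one dart at a time, so
    [reach x] is never left. *)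
Lemma graph_cycle_reach x c y z :
  graph_cycle c -> y \in c -> z \in c ->
  left_face y \in reach x -> left_face z \in reach x.
Proof.
move=> /and4P[_ cyc _ _] /rot_to[i p Ep] zc yx.
move: cyc zc; rewrite /closed_walk -(rot_cycle i) -(mem_rot i) Ep /= rcons_path.
case/andP=> + _.
elim: p y yx {Ep} => [|t p IHp] y yx /=.
  by rewrite mem_seq1 => _ /eqP->.
case/andP=> /eqP yt tp; rewrite inE => /predU1P[->//|].
apply: IHp tp; apply: left_face_porbit yt _.
by rewrite reach_closed /right_face oppK.
Qed.

Lemma covering_cycle x :
  x \notin val o ->
  exists w, [/\ path.cycle step w, x \in w, {subset w <= [predC val o]} &
    forall c, graph_cycle c -> edge_set c :&: edge_set w != set0 ->
      edge_set c \subset edge_set w].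
Proof.
move=> xo.
have [|p [xp px cover]] := covering_path (s := enum (connect step x)) xo.
  by move=> y; rewrite mem_enum.
have in_reach y : y \in x :: p -> left_face y \in reach x.
  by move=> yp; rewrite reach_closed; apply/imset_f/(path_connect xp).
(* One of [y] and [opp y] lies outside [o]; that dart is reachable, hence on the walk. *)
have coverE y : left_face y \in reach x -> edge y \in edge_set (x :: p).
  move=> yx; have [yo|yo] := boolP (y \in val o); last first.
    by apply/edge_setP; exists y; rewrite ?cover // mem_enum; apply: connect_reach.
  rewrite -edge_opp; apply/edge_setP; exists (opp y) => //.
  rewrite cover // mem_enum; apply: connect_reach.
    by rewrite orientation_opp yo.
  by rewrite reach_closed /right_face oppK.
exists (x :: p); split; [by rewrite /= rcons_path xp px|exact: mem_head| |].
  by move=> y; rewrite inE => /predU1P[->//|]; apply: path_step_notin xp _.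
move=> c cyc /set0Pn[_ /setIP[/edge_setP[y yc ->] /edge_setP[z /in_reach zx yz]]].
apply/subsetP => _ /edge_setP[t tc ->]; apply: coverE.
apply: graph_cycle_reach cyc yc tc _.
by case: (edge_eq yz) => -> //; rewrite reach_closed /right_face oppK.
Qed.

Lemma acyclic_graph_cycle c :
  graph_cycle c ->
  (exists2 y, y \in c & y \notin val o) /\ (exists2 y, y \in c & y \in val o).
Proof.
move=> cyc; split.
  by apply/allPn/negP => /allP co; apply: aco; exists c.
apply/hasP; apply/negPn/negP => /hasPn nco; apply: aco.
case/and4P: cyc => c0 cyc _ _.
have [y yc] : exists y, y \in c by case: (c) c0 => // y s _; exists y; apply: mem_head.
(* If no dart of [c] is in [o], the reverse of [c] is directed; the successor of [z] is the opposite
   of the dart preceding [opp z] in [c]. *)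
apply: (@graph_cycle_exists o [pred y | opp y \in c] (opp y)) => [|z /nco|z zc].
- by rewrite /= oppK.
- by rewrite orientation_opp negbK.
exists (opp (prev c (opp z))); first by rewrite /= oppK mem_prev.
exact/eqP/(prev_cycle cyc zc).
Qed.

End Acyclic.
End SurfaceGraph.

(** * Transfer to the dual graph *)

Section Dual.
Variable G : surface_graph.
Implicit Types (d x y : dart G) (o : orientation G) (c : seq (dart G)).

Lemma mem_dual_orientation o d :
  (d \in val (dual_orientation o)) = (d \notin val o).
Proof.
rewrite -orientation_opp -{1}[d]oppK.
exact: (mem_imset _ _ (@perm_inj _ opp)).
Qed.

(** Faces of the dual are vertices of [G]: the one on the right of [d] is its tail, the one on the
    left its head. *)
Lemma cocycle_dual c : cocycle (G := dual G) c = graph_cycle c.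
Proof.
have rE (d e : dart G) : (@right_face (dual G) d == @right_face (dual G) e)
            = (tail d == tail e).
  have [F B] := @left_face_dual_dart G d e.
  by apply/eqP/eqP; [apply: F | apply: B].
have lE (d e : dart G) : (@left_face (dual G) d == @right_face (dual G) e)
            = (head d == tail e).
  by rewrite -[d in LHS](@oppK G); apply: (rE (opp d) e).
congr [&& _, _, _ & _]; first exact: eq_cycle.
elim: c => //= d c ->; congr (~~ _ && _).
by apply/mapP/mapP => -[e ec /eqP E]; exists e => //; apply/eqP; move: E; rewrite rE.
Qed.

Lemma dual_biwalkable o : acyclic o -> totally_biwalkable (dual_orientation o).
Proof.
move=> aco _ /imsetP[d _ ->].
have [x xo ->] : exists2 x : dart G, x \notin val o & edge d = edge x.
  have [ndo|] := boolP (d \in val o); last by exists d.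
  by exists (opp d : dart G); rewrite ?orientation_opp ?ndo // edge_opp.
have [w [cyc_w xw wo sub_w]] := covering_cycle aco xo.
exists w; split; last by apply/edge_setP; exists x.
split.
- by apply: sub_cycle cyc_w => y z /andP[].
- by move=> y /wo; rewrite mem_dual_orientation.
move=> c; rewrite cocycle_dual => cyc meet.
have /(setIidPl) cw := sub_w c cyc meet.
have Uc : uniq (map (@edge (dual G)) c) by case/and4P: cyc.
have [[y yc yo] [z zc zo]] := acyclic_graph_cycle aco cyc.
exists (edge y), (edge z); split; try by rewrite [_ :&: _]cw; apply: imset_f.
rewrite /coherently_oriented !left_to_right_edge ?right_to_left_edge //.
by rewrite !mem_dual_orientation yo zo.
Qed.

Lemma biwalkable_acyclic o : totally_biwalkable (dual_orientation o) -> acyclic o.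
Proof.
move=> bo [c [cyc co]].
have [y yc] : exists y, y \in c.
  by case/and4P: cyc; case: (c) => // y s _; exists y; apply: mem_head.
have [w [[_ _ bw] yw]] := bo (edge y) (imset_f _ (in_setT y)).
have Uc : uniq (map (@edge (dual G)) c) by case/and4P: cyc.
have [||e1 [e2 [/setIP[ec1 _] /setIP[ec2 _]]]] := bw c.
- by rewrite cocycle_dual.
- by apply/set0Pn; exists (edge y); rewrite inE yw andbT; apply: imset_f.
case/edge_setP: ec1 => y1 y1c ->; case/edge_setP: ec2 => y2 y2c ->.
(* Darts of [c] lie in [o], so the dual orientation selects their opposites and every edge crosses
   from right to left. *)
rewrite /coherently_oriented !right_to_left_edge // !mem_dual_orientation !negbK.
by rewrite !co // orbT.
Qed.

End Dual.

Theorem theorem3p8 (G : surface_graph) :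
  functions.set_bij (AO G) (TBO (dual G)) (@dual_orientation G).
Proof.
split.
- exact: dual_biwalkable.
- move=> o1 o2 _ _ E; apply/val_inj/setP => d.
  by apply: negb_inj; rewrite -!mem_dual_orientation E.
move=> p bp.
have oP : [forall d : dart G, (opp d \in ~: val p) == (d \notin ~: val p)].
  apply/forallP => d; rewrite !inE; apply/eqP; congr (~~ _).
  exact: orientation_opp p d.
(* Dualizing complements the set of darts, so the preimage of [p] is its complement. *)
pose o : orientation G := exist _ (~: val p) oP.
have E : dual_orientation o = p.
  by apply/val_inj/setP => d; rewrite mem_dual_orientation inE negbK.
by exists o => //; apply: biwalkable_acyclic; rewrite E.
Qed.
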